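(* Let $q$ be a power of an odd prime and let $\mathrm{N}:\mathbb F_{q^3}\to\mathbb F_q$, $\mathrm{N}(z)=z^{1+q+q^2}$, be the norm function. For $a,b\in\mathbb F_{q^3}^*$, the function $x\mapsto x^{q+1}+ax^{2q}+bx^2$ is planar on $\mathbb F_{q^3}$ if and only if at least one of the following holds: (i) $4ab=1$ and $\mathrm{N}(2a)\ne-1$; or (ii) $4ab\ne1$ and $\mathrm{N}(a)+\mathrm{N}(b)+ab=0$.
   Context: $\mathbb F_{q^3}$ is the finite field with $q^3$ elements, an extension of $\mathbb F_q$ of degree $3$, with $q$ odd; $\mathbb F_{q^3}^*$ is its set of nonzero elements. A function $f:\mathbb F_{q^3}\to\mathbb F_{q^3}$ is called planar on $\mathbb F_{q^3}$ if for every $c\in\mathbb F_{q^3}^*$ the map $x\mapsto f(x+c)-f(x)$ is a permutation of $\mathbb F_{q^3}$. *)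

(* Defs.v *)
From mathcomp Require Import all_boot all_order all_algebra all_field.

Set Implicit Arguments.
Unset Strict Implicit.
Unset Printing Implicit Defensive.

Import GRing.Theory.
Local Open Scope ring_scope.

Definition planar (F : finFieldType) (f : F -> F) : Prop :=
  forall c : F, c != 0 -> bijective (fun x => f (x + c) - f x).

(* The norm from the field with q ^ 3 elements to its subfield with q elements.
   The subfield is the set of solutions of z ^+ q = z, and the values of the
   norm are kept as elements of F; cubic_norm_subfield shows that they lie in
   the subfield. *)
Definition cubic_norm (F : finFieldType) (q : nat) (z : F) : F :=
  z ^+ (1 + q + q ^ 2).

Lemma cubic_norm_subfield (F : finFieldType) (q : nat) (z : F) :
  #|F| = (q ^ 3)%N -> cubic_norm q z ^+ q = cubic_norm q z.
Proof.
move=> cardF; have zq3 : z ^+ (q ^ 3) = z by rewrite -cardF expf_card.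
rewrite /cubic_norm -exprM !mulnDl mul1n -[(q * q)%N]/(q ^ 2)%N -expnSr.
by rewrite exprD zq3 -exprSr -addnA add1n.
Qed.

(* Main.v *)
Require Import Defs.
From mathcomp Require Import all_boot all_order all_algebra all_field.
From mathcomp Require Import cyclic ring zify.

Set Implicit Arguments.
Unset Strict Implicit.
Unset Printing Implicit Defensive.

Import GRing.Theory.
Local Open Scope ring_scope.

(**
Write z', z'' for z ^+ q, z ^+ q ^+ q, let N be the norm, A = 2a and B = 2b.
The map x |-> f (x + c) - f x is affine over the field with q elements, and its
linear part vanishes at x exactly when u + v + A u v + B = 0 for
u = x ^+ (q - 1) and v = c ^+ (q - 1).  By Hilbert's theorem 90 these (q - 1)-th
powers are all the elements of norm 1, so f is planar if and only if the
equation has no solution of norm 1 ([planar_norm1]).  Solving it for v, this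
says that N (1 + A u) + N (u + B) has no zero u of norm 1
([norm1_pair_norm_sum]).  For N u = 1 that sum is the trace form
Tr (alpha u) + Tr (beta / u) + gamma with alpha = A + B' B'',
beta = B + A' A'' and gamma = 2 + N A + N B ([norm_sum_trace_form]).

If AB = 1, the equation factors as (1 + A u) (v + B) = 0.  If
N A + N B + 2 AB = 0, then AB lies in the small field and the trace form is a
nonzero multiple of N (1 - w u) for an explicit w with N w <> 1, so it has no
zero ([relation_no_norm1_zero]).

The converse is the deep half.  The zeros of the trace form are the rational
points of a plane cubic, for a Frobenius map that permutes the coordinates
cyclically, and a plane cubic without rational point has to split into three
conjugate lines.  Since u |-> 1 / u exchanges alpha and beta, take beta <> 0
(if alpha = beta = 0, then N A = N B = - AB and the relation holds).
In the coordinates u and v = u', the cubic has an equation R (u, v) = 0 with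
R = v l(v) u^2 + m(v) u + c(v), and P (u) = R (u, u^q) has degree 2q + 2.
A root u of P is a point X whose Frobenius image F X lies on the line through X
and a fixed base point of the cubic.  If F X <> X, then F X is the second point
of that line, which forces l(v) = c(v) (uv)^(q-1) at v = u^q.  The resultant
M (v) of this relation with R, freed from its denominator, has degree at most
2q.  When no F X equals X, it vanishes at the 2q + 2 values v = u^q: two of
them can coincide only at a double root of P, and there l, m and c all vanish.
So M = 0, unless l, m and c have a common root, and M = 0 implies that they
have one: in both cases the cubic contains a line
([no_norm1_zero_reducible_closed]).  No estimate for the number of points is
involved, and the argument holds for every q.  Writing out that l, m and c have
a common root gives AB = 1 or N A + N B + 2 AB = 0
([no_norm1_zero_relation]).
*)

(** * Polynomials of bounded degree *)

Lemma size_polyM_le (R : nzSemiRingType) (f h : {poly R}) (m n : nat) :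
  (size f <= m.+1)%N -> (size h <= n.+1)%N -> (size (f * h)%R <= (m + n).+1)%N.
Proof. by move=> sf sh; apply: leq_trans (size_polyMleq _ _) _; lia. Qed.

Lemma size_polyX_le (R : nzSemiRingType) (f : {poly R}) (m n : nat) :
  (size f <= m.+1)%N -> (size (f ^+ n)%R <= (m * n).+1)%N.
Proof. by move=> sf; apply: leq_trans (size_poly_exp_leq _ _) _; nia. Qed.

(** The power sum x ^+ n + y ^+ n is a polynomial in x + y and x * y, so it
    stays polynomial of the expected degree when x and y are the two roots of
    a quadratic equation whose coefficients are polynomials in v. *)
Lemma power_sum_poly (R : comNzRingType) (d : nat) (s m : {poly R}) (n : nat) :
  (size s <= d.+1)%N -> (size m <= (d + d).+1)%N ->
  exists2 S : {poly R}, (size S <= (d * n).+1)%N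
    & forall v x y, x + y = s.[v] -> x * y = m.[v] -> S.[v] = x ^+ n + y ^+ n.
Proof.
move=> ss sm.
pose good i (S : {poly R}) := (size S <= (d * i).+1)%N /\ forall v x y,
  x + y = s.[v] -> x * y = m.[v] -> S.[v] = x ^+ i + y ^+ i.
suff [S0 [S1 [[sS evS] _]]] : exists S0 S1 : {poly R}, good n S0 /\ good n.+1 S1.
  by exists S0.
(* Newton's recurrence involves two consecutive power sums. *)
elim: n => [|n [S0 [S1 [[sS0 ev0] [sS1 ev1]]]]].
  exists 2%:R%:P, s; split; split; first by rewrite muln0 size_polyC leq_b1.
  - by move=> v x y _ _; rewrite hornerC !expr0.
  - by rewrite muln1.
  - by move=> v x y <- _; rewrite !expr1.
exists S1, (s * S1 - m * S0); split; split=> //.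
  have s1 : (size (s * S1)%R <= (d * n.+2).+1)%N.
    by rewrite mulnS; apply: size_polyM_le.
  have s2 : (size (m * S0)%R <= (d * n.+2).+1)%N.
    by rewrite !mulnS addnA; apply: size_polyM_le.
  by rewrite (leq_trans (size_polyD _ _)) // geq_max size_polyN s1.
move=> v x y es em; rewrite hornerD hornerN !hornerM -es -em.
rewrite (ev0 v x y) // (ev1 v x y) // !exprS; ring.
Qed.

(** * The q-power map *)

Section Frobenius.
Variables (R : comNzRingType) (p k : nat).
Hypotheses (pcharR : p \in [pchar R]).

Lemma frobD (x y : R) : (x + y) ^+ (p ^ k) = x ^+ (p ^ k) + y ^+ (p ^ k).
Proof.
by apply: exprDn_pchar; rewrite pnatX (pnatE _ (pcharf_prime pcharR)) pcharR.
Qed.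

Lemma frobN (x : R) : (- x) ^+ (p ^ k) = - x ^+ (p ^ k).
Proof.
by apply: exprNn_pchar; rewrite pnatX (pnatE _ (pcharf_prime pcharR)) pcharR.
Qed.

End Frobenius.

Lemma expf_pchar_inj (K : fieldType) (p k : nat) :
  p \in [pchar K] -> injective (fun x : K => x ^+ (p ^ k)).
Proof.
move=> pcharK x y /eqP; rewrite -subr_eq0 -(frobN _ pcharK) -(frobD _ pcharK).
by rewrite expf_eq0 subr_eq0 => /andP[_ /eqP].
Qed.

(** * Cubics without rational points contain a line *)

(** Both equations come from the cubic R (x, v) = v l x^2 + m x + c = 0: the
    first says that u is a root, the second, multiplied by 1 / (v t^2), that
    1 / (v t) is one.  Unless these roots coincide, they are the two
    roots, and their product c / (v l) gives the conclusion. *)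
Lemma second_root_product (R : idomainType) (u v t l m c : R) :
  v * l * u ^+ 2 + m * u + c = 0 -> l + m * t + c * v * t ^+ 2 = 0 ->
  u * v * t != 1 -> l * u = c * t.
Proof.
move=> e1 e2; rewrite -subr_eq0 => /mulfI inj.
apply/eqP; rewrite -subr_eq0; apply/eqP/inj; rewrite mulr0.
suff -> : (u * v * t - 1) * (l * u - c * t) =
  (v * l * u ^+ 2 + m * u + c) * t - (l + m * t + c * v * t ^+ 2) * u.
  by rewrite e1 e2 !mul0r subr0.
ring.
Qed.

(** For u != 0 the relation l u = c t of [second_root_product] reads
    l = c (u v)^(q-1).  Up to a power of l, the left-hand side below is the
    resultant in x of l - c (x v)^(q-1) and v l x^2 + m x + c: the product of
    the values of the former at the two roots of the latter.  To avoid
    denominators, S is the power sum of the roots multiplied by v l. *)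
Lemma resultant_vanishes (K : fieldType) (q : nat) (u l m c S : K) :
  (0 < q)%N -> let v := u ^+ q in let t := v ^+ q in
  v * l * u ^+ 2 + m * u + c = 0 -> l + m * t + c * v * t ^+ 2 = 0 ->
  u * v * t != 1 ->
  (forall x y, x + y = - m -> x * y = v * l * c -> S = x ^+ q.-1 + y ^+ q.-1) ->
  l ^+ q.+1 - l * c * S + c ^+ q.+1 * v ^+ q.-1 = 0.
Proof.
move=> q_gt0 v t e1 e2 n1 eS.
have luct := second_root_product e1 e2 n1.
have [u0|u_neq0] := eqVneq u 0.
  have v0 : v = 0 by rewrite /v u0 expr0n; case: (q) q_gt0.
  have t0 : t = 0 by rewrite /t v0 expr0n; case: (q) q_gt0.
  move: e1 e2; rewrite v0 t0 u0 !(mul0r, mulr0, expr0n, add0r, addr0) => -> ->.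
  by rewrite !exprS !mul0r subrr addr0.
have v_neq0 : v != 0 by rewrite expf_neq0.
have t_neq0 : t != 0 by rewrite expf_neq0.
(* x and y are v * l times the roots u and 1 / (v * t). *)
pose x := v * l * u; pose y := - m - x.
have xy : x * y = v * l * c.
  have -> : x * y = - (v * l) * (v * l * u ^+ 2 + m * u + c) + v * l * c.
    by rewrite /y /x; ring.
  by rewrite e1 mulr0 add0r.
have ty : t * y = l.
  have -> : t * y = l - (l + m * t + c * v * t ^+ 2) - v * t * (l * u - c * t).
    by rewrite /y /x; ring.
  by rewrite e2 luct !subrr mulr0 !subr0.
have {eS} -> := eS x y (_ : x + y = - m) xy; last by rewrite /y; ring.
have ec : c = l * u / t by rewrite luct mulfK.
have -> : y = l / t by rewrite -ty mulrC mulKf.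
have eu : u ^+ q.-1 = v / u by rewrite /v -[in RHS](prednK q_gt0) exprSr mulfK.
have ev : v ^+ q.-1 = t / v by rewrite /t -[in RHS](prednK q_gt0) exprSr mulfK.
have el : l ^+ q.+1 = l ^+ 2 * l ^+ q.-1 by rewrite -exprD addnC addn2 prednK.
rewrite el [c ^+ _](_ : _ = c ^+ 2 * c ^+ q.-1); last first.
  by rewrite -exprD addnC addn2 prednK.
rewrite ec /x !exprMn eu ev exprVn.
have : t ^+ q.-1 != 0 by rewrite expf_neq0.
by move=> z; field; rewrite z u_neq0 v_neq0 t_neq0.
Qed.

(** When u v t = 1 this is Tr (a u) + Tr (b / u) + g for the conjugates a0, a1,
    a2 of a, b0, b1, b2 of b and u, v, t of u; the reciprocals are written as
    products so that the form makes sense in a ring. *)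
Definition trace_form (R : comNzRingType) (a0 a1 a2 b0 b1 b2 g u v t : R) : R :=
  a0 * u + a1 * v + a2 * t + b0 * (v * t) + b1 * (t * u) + b2 * (u * v) + g.

Section ClosedField.

Variables (K : closedFieldType) (p k : nat).
Hypotheses (pcharK : p \in [pchar K]) (k_gt0 : (0 < k)%N).
Let q := (p ^ k)%N.

Variables a0 a1 a2 b0 b1 b2 g : K.
Hypotheses (a01 : a0 ^+ q = a1) (a12 : a1 ^+ q = a2) (a20 : a2 ^+ q = a0).
Hypotheses (b01 : b0 ^+ q = b1) (b12 : b1 ^+ q = b2) (b20 : b2 ^+ q = b0).
Hypotheses (gq : g ^+ q = g) (b0_neq0 : b0 != 0).

(* For u * v * t = 1, the trace form times u * v is
   v * lead.[v] * u ^+ 2 + middle.[v] * u + const.[v]. *)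
Let lead : {poly K} := a0%:P + b2%:P * 'X.
Let middle : {poly K} := b1%:P + g%:P * 'X + a1%:P * 'X^2.
Let const : {poly K} := a2%:P + b0%:P * 'X.

Hypothesis no_root : forall u, let v := u ^+ q in let t := v ^+ q in
  u * v * t = 1 -> trace_form a0 a1 a2 b0 b1 b2 g u v t != 0.

Let q_gt1 : (1 < q)%N.
Proof. by rewrite -(exp1n k) ltn_exp2r // prime_gt1 // (pcharf_prime pcharK). Qed.

Let b2_neq0 : b2 != 0.
Proof. by rewrite -b12 -b01 !expf_neq0. Qed.

Let leadE v : lead.[v] = a0 + b2 * v.
Proof. by rewrite /lead !hornerE. Qed.

Let middleE v : middle.[v] = b1 + g * v + a1 * v ^+ 2.
Proof. by rewrite /middle !hornerE. Qed.

Let constE v : const.[v] = a2 + b0 * v.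
Proof. by rewrite /const !hornerE. Qed.

Let P : {poly K} := b2%:P * 'X^(2 * q + 2) +
  (a0%:P * 'X^(q + 2) + a1%:P * 'X^(2 * q + 1) + g%:P * 'X^(q + 1) +
   b1%:P * 'X + b0%:P * 'X^q + a2%:P).

Let PE u :
  P.[u] = u ^+ q * lead.[u ^+ q] * u ^+ 2 + middle.[u ^+ q] * u + const.[u ^+ q].
Proof.
rewrite leadE middleE constE /P.
by rewrite !(hornerD, hornerM, hornerC, hornerXn, hornerX) !exprD; ring.
Qed.

(** The powers of X ^ q are constants for the derivation. *)
Let derivPE u : P^`().[u] = 2%:R * (u ^+ q * lead.[u ^+ q] * u) + middle.[u ^+ q].
Proof.
have q0 : q%:R = 0 :> K.
  by rewrite /q natrX (pcharf0 pcharK) expr0n eqn0Ngt k_gt0.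
have dXq : ('X^q : {poly K})^`() = 0.
  by rewrite derivXn -mulr_natr -polyC_natr q0 mulr0.
rewrite leadE middleE /P !exprD.
rewrite !(derivD, derivM, derivC, dXq, derivX, derivXn).
rewrite !(hornerD, hornerM, hornerC, hornerXn, hornerX, hornerMn) /=.
rewrite !(mulr0n, mulr1n, expr0, expr1).
ring.
Qed.

Let sizeP : size P = (2 * q + 3)%N.
Proof.
have szCX (z : K) n : (n < 2 * q + 2)%N ->
    (size (z%:P * 'X^n)%R <= 2 * q + 2)%N.
  by move=> n_lt; rewrite mul_polyC (leq_trans (size_scale_leq _ _)) // size_polyXn.
have szC (z : K) : (size z%:P <= 2 * q + 2)%N.
  by rewrite (leq_trans (size_polyC_leq1 _)) //; lia.
have szD (f h : {poly K}) : (size f <= 2 * q + 2)%N ->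
    (size h <= 2 * q + 2)%N -> (size (f + h)%R <= 2 * q + 2)%N.
  by move=> sf sh; rewrite (leq_trans (size_polyD _ _)) // geq_max sf.
have size_top : size (b2%:P * 'X^(2 * q + 2)) = (2 * q + 3)%N.
  by rewrite mul_polyC size_scale // size_polyXn addn3 addn2.
rewrite /P size_polyDl ?size_top // [X in (_ < X)%N]addnS ltnS.
by repeat apply szD; rewrite ?szC ?szCX ?(szCX b1 1%N) //; lia.
Qed.

(** This is the q-th power of the equation P.[u] = 0. *)
Let P_conj u : P.[u] = 0 -> let v := u ^+ q in let t := v ^+ q in
  lead.[v] + middle.[v] * t + const.[v] * v * t ^+ 2 = 0.
Proof.
move=> /(congr1 (fun x => x ^+ q)) Pu v t; move: Pu.
rewrite PE !leadE !middleE !constE expr0n [q == 0%N]eqn0Ngt (ltnW q_gt1) /=.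
rewrite !(frobD k pcharK, exprMn) a01 a12 a20 b01 b12 b20 gq -/v -/t => Pu.
by rewrite -[RHS]Pu; ring.
Qed.

Let P_root_norm u : P.[u] = 0 -> u * u ^+ q * u ^+ q ^+ q != 1.
Proof.
move=> Pu0; apply/eqP => uvt; have /negP[] := no_root uvt; move: Pu0.
rewrite PE leadE middleE constE => Pu0.
have [u0|u_neq0] := eqVneq u 0.
  by move: uvt (oner_neq0 K) => <-; rewrite u0 !mul0r eqxx.
have uv_neq0 : u * u ^+ q != 0 by rewrite mulf_neq0 // expf_neq0.
rewrite -(mulrI_eq0 _ (mulfI uv_neq0)) /trace_form.
move: uvt Pu0; set v := u ^+ q; set t := v ^+ q => uvt Pu0.
rewrite [X in X == 0](_ : _ = (v * (a0 + b2 * v) * u ^+ 2 +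
  (b1 + g * v + a1 * v ^+ 2) * u + (a2 + b0 * v)) +
  (u * v * t - 1) * (a2 + b0 * v + b1 * u)); last by ring.
by rewrite Pu0 uvt subrr mul0r addr0.
Qed.

(** At a double root u the two roots u and 1 / (v t) of the quadratic equation
    over v = u ^+ q coincide, which contradicts [P_root_norm] unless the equation
    degenerates. *)
Let multiple_root u : P.[u] = 0 -> P^`().[u] = 0 ->
  [/\ lead.[u ^+ q] = 0, middle.[u ^+ q] = 0 & const.[u ^+ q] = 0].
Proof.
move=> Pu; rewrite derivPE => P'u.
have e1 := Pu; rewrite PE in e1; have e2 := P_conj Pu.
have luct := second_root_product e1 e2 (P_root_norm Pu).
have l0 : lead.[u ^+ q] = 0.
  have : (u * u ^+ q * u ^+ q ^+ q - 1) * lead.[u ^+ q] = 0.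
    move: e2 P'u luct; set l := lead.[_]; set m := middle.[_]; set c := const.[_].
    set v := u ^+ q; set t := v ^+ q => e2 P'u luct.
    have -> : (u * v * t - 1) * l = t * (2%:R * (v * l * u) + m) -
        (l + m * t + c * v * t ^+ 2) - v * t * (l * u - c * t) by ring.
    by rewrite P'u e2 luct subrr !mulr0 !subr0.
  by move/eqP; rewrite mulf_eq0 subr_eq0 (negPf (P_root_norm Pu)) => /eqP.
have m0 : middle.[u ^+ q] = 0 by move: P'u; rewrite l0 mulr0 mul0r mulr0 add0r.
by split=> //; move: e1; rewrite l0 m0 mulr0 !mul0r !add0r.
Qed.

Let size_linear (x y : K) : (size (x%:P + y%:P * 'X)%R <= 2)%N.
Proof.
rewrite addrC size_MXaddC; case: ifP => // _.
by rewrite ltnS size_polyC_leq1.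
Qed.

Let size_middle : (size middle <= 3)%N.
Proof.
rewrite (leq_trans (size_polyD _ _)) // geq_max (leq_trans (size_linear _ _)) //.
by rewrite mul_polyC (leq_trans (size_scale_leq _ _)) // size_polyXn.
Qed.

Let size_lead : (size lead <= 2)%N.
Proof. exact: size_linear. Qed.

Let size_const : (size const <= 2)%N.
Proof. exact: size_linear. Qed.

Section Eliminant.

Variable S : {poly K}.
Hypothesis sizeS : (size S <= (2 * q.-1).+1)%N.
Hypothesis SE : forall v x y, x + y = (- middle).[v] ->
  x * y = ('X * lead * const).[v] -> S.[v] = x ^+ q.-1 + y ^+ q.-1.

(** The left-hand side of [resultant_vanishes], as a polynomial in v = u ^+ q. *)
Let M := lead ^+ q.+1 - lead * const * S + const ^+ q.+1 * 'X^(q.-1).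

Let ME v : M.[v] = lead.[v] ^+ q.+1 - lead.[v] * const.[v] * S.[v] +
  const.[v] ^+ q.+1 * v ^+ q.-1.
Proof.
rewrite leadE constE /M.
by rewrite !(hornerD, hornerN, hornerM, horner_exp, hornerX, hornerC).
Qed.

Let sizeM : (size M <= 2 * q + 1)%N.
Proof.
have s1 : (size (lead ^+ q.+1)%R <= 2 * q + 1)%N.
  apply: leq_trans (size_polyX_le _ size_lead) _; lia.
have s2 : (size (const ^+ q.+1 * 'X^(q.-1))%R <= 2 * q + 1)%N.
  apply: (@leq_trans (1 * q.+1 + q.-1).+1); last by lia.
  by apply: size_polyM_le; rewrite ?size_polyXn ?size_polyX_le.
have s3 : (size (lead * const * S)%R <= 2 * q + 1)%N.
  apply: (@leq_trans (1 + 1 + 2 * q.-1).+1); last by lia.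
  by apply: size_polyM_le => //; apply: size_polyM_le.
rewrite /M (leq_trans (size_polyD _ _)) // geq_max s2 andbT.
by rewrite (leq_trans (size_polyD _ _)) // geq_max s1 size_polyN.
Qed.

(** The q-th powers of the 2q + 2 roots of P are distinct zeros of M, whose
    degree is at most 2q. *)
Let M_eq0 : coprimep P P^`() -> M = 0.
Proof.
move=> sepP; apply/eqP; apply: contraT => M_neq0.
have [rs defP] := closed_field_poly_normal P.
have P_neq0 : P != 0 by rewrite -size_poly_eq0 sizeP addn3.
have size_rs : size rs = (2 * q + 2)%N.
  move: sizeP; rewrite defP size_scale ?lead_coef_eq0 // size_prod_XsubC.
  by rewrite addnS => -[].
have uniq_rs : uniq rs.
  have lcP : lead_coef P != 0 by rewrite lead_coef_eq0.
  rewrite -separable_prod_XsubC -(eqp_separable (eqp_scale _ lcP)).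
  by rewrite -defP unlock.
have rootP u : u \in rs -> P.[u] = 0.
  by move=> urs; apply/rootP; rewrite defP rootZ ?lead_coef_eq0 // root_prod_XsubC.
have uniq_vs : uniq [seq u ^+ q | u <- rs].
  by rewrite map_inj_uniq //; apply: expf_pchar_inj.
have all_root : all (root M) [seq u ^+ q | u <- rs].
  rewrite all_map; apply/allP => u /rootP Pu0; apply/eqP.
  have e1 := Pu0; rewrite PE in e1.
  rewrite ME; apply: (resultant_vanishes (ltnW q_gt1) e1 (P_conj Pu0)
    (P_root_norm Pu0)) => x y exy xy.
  by apply: SE; rewrite ?hornerN // !hornerM hornerX.
have := max_poly_roots M_neq0 all_root uniq_vs.
by rewrite size_map size_rs ltnNge (leq_trans sizeM) // addn2 addn1 ltnW.
Qed.

(** At the root r of const the vanishing of M leaves lead.[r] = 0.  Then lead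
    is a multiple of const, and M is divisible by the square of const. *)
Let common_root_of_M_eq0 : M = 0 ->
  exists r, [/\ lead.[r] = 0, middle.[r] = 0 & const.[r] = 0].
Proof.
move=> M0.
pose r := - a2 / b0.
have const_r : const.[r] = 0 by rewrite constE /r mulrC divfK ?subrr.
have lead_r : lead.[r] = 0.
  have /eqP := congr1 (fun N : {poly K} => N.[r]) M0.
  by rewrite ME const_r mulr0 mul0r subr0 expr0n mul0r addr0 horner0 expf_eq0 => /eqP.
pose ka := b2 / b0.
have lead_const : lead = ka%:P * const.
  move: lead_r; rewrite leadE => lead_r; rewrite /lead /const mulrDr mulrA -!polyCM.
  congr (_%:P + _%:P * _); last by rewrite /ka divfK.
  by rewrite -[a0]subr0 -lead_r /ka /r; field.
have const_neq0 : const != 0.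
  apply: contraNneq b0_neq0 => c0; have := congr1 (coefp 1) c0.
  by rewrite /= /const coefD coefCM coefX coefC /= mulr1 add0r coef0 => ->.
(* Now M = const ^+ 2 * Q, and Q.[r] = 0 says that the power sum of
   - middle.[r] and 0 vanishes. *)
have middle_r : middle.[r] = 0.
  pose Q := const ^+ q.-1 * (ka ^+ q.+1)%:P - ka%:P * S + const ^+ q.-1 * 'X^(q.-1).
  have Q0 : Q = 0.
    suff /eqP : const ^+ 2 * Q = 0.
      by rewrite mulf_eq0 expf_eq0 (negPf const_neq0) andbF => /eqP.
    have eq2 : const ^+ q.+1 = const ^+ 2 * const ^+ q.-1.
      by rewrite -exprD addnC addn2 prednK // ltnW.
    rewrite -M0 /M lead_const exprMn -polyC_exp eq2 /Q; ring.
  have := congr1 (horner^~ r) Q0; rewrite /Q.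
  have QE : Q.[r] = const.[r] ^+ q.-1 * ka ^+ q.+1 - ka * S.[r] +
      const.[r] ^+ q.-1 * r ^+ q.-1.
    rewrite constE /Q.
    by rewrite !(hornerD, hornerN, hornerM, horner_exp, hornerX, hornerC).
  rewrite -/Q QE const_r.
  rewrite (@SE r (- middle.[r]) 0) ?hornerN ?addr0 ?mulr0 ?hornerM ?const_r ?mulr0 //.
  rewrite !expr0n; have -> : (q.-1 == 0)%N = false by move: q_gt1; lia.
  rewrite !mul0r addr0 sub0r horner0 addr0.
  by move/eqP; rewrite oppr_eq0 mulf_eq0 expf_eq0 oppr_eq0 /ka mulf_eq0 invr_eq0
    (negPf b2_neq0) (negPf b0_neq0) => /andP[_ /eqP].
by exists r.
Qed.

Lemma common_root_of_no_norm1_zero :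
  exists r, [/\ lead.[r] = 0, middle.[r] = 0 & const.[r] = 0].
Proof.
have [/M_eq0 /common_root_of_M_eq0 //|] := boolP (coprimep P P^`()).
rewrite /coprimep => /closed_rootP[u]; rewrite root_gcd => /andP[/rootP Pu /rootP].
by move=> /(multiple_root Pu); exists (u ^+ q).
Qed.

End Eliminant.

(** The common root of lead, middle and const is - a2 / b0; the conclusion
    states this without division. *)
Lemma no_norm1_zero_reducible_closed :
  a0 * b0 = b2 * a2 /\ b1 * b0 ^+ 2 - g * a2 * b0 + a1 * a2 ^+ 2 = 0.
Proof.
have [S sizeS SE] : exists2 S : {poly K}, (size S <= (2 * q.-1).+1)%N
    & forall v x y, x + y = (- middle).[v] ->
      x * y = ('X * lead * const).[v] -> S.[v] = x ^+ q.-1 + y ^+ q.-1.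
  apply: power_sum_poly; rewrite ?size_polyN //.
  apply: (@leq_trans (1 + 1 + 1).+1) => //.
  by do 2?[apply: size_polyM_le => //]; rewrite size_polyX.
have [r []] := common_root_of_no_norm1_zero sizeS SE.
rewrite leadE middleE constE => l0 m0 c0.
have ea2 : a2 = - (b0 * r) by apply/eqP; rewrite -addr_eq0 c0.
have ea0 : a0 = - (b2 * r) by apply/eqP; rewrite -addr_eq0 l0.
split; first by rewrite ea2 ea0; ring.
rewrite ea2 [LHS](_ : _ = b0 ^+ 2 * (b1 + g * r + a1 * r ^+ 2)); last by ring.
by rewrite m0 mulr0.
Qed.

End ClosedField.

(** * Descent to the finite field *)

Section CubicExtension.

Variables (p k : nat) (F : finFieldType).
Hypotheses (p_prime : prime p) (k_gt0 : (0 < k)%N).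
Let q := (p ^ k)%N.
Hypothesis cardF : #|F| = (q ^ 3)%N.

Let pcharF : p \in [pchar F].
Proof. by apply: (@card_finPcharP F p (k * 3)) => //; rewrite cardF -expnM. Qed.

Let frob3 (x : F) : x ^+ q ^+ q ^+ q = x.
Proof. by rewrite -!exprM -[RHS]expf_card cardF. Qed.

Let frobD (x y : F) : (x + y) ^+ q = x ^+ q + y ^+ q.
Proof. exact: frobD. Qed.

(** An element of norm 1 in an extension is fixed by the q^3-power map, as
    follows by comparing its norm with the q-th power of its norm. *)
Lemma norm1_in_subfield (K : fieldType) (iota : {rmorphism F -> K}) (u : K) :
  u * u ^+ q * u ^+ q ^+ q = 1 -> exists x, u = iota x.
Proof.
move=> Nu; have u_neq0 : u != 0.
  by apply: contra_eq_neq Nu => ->; rewrite !mul0r eq_sym oner_neq0.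
have uq3 : u ^+ q ^+ q ^+ q = u.
  apply: (mulfI (_ : u ^+ q * u ^+ q ^+ q != 0)); first by rewrite mulf_neq0 // !expf_neq0.
  have := congr1 (fun z => z ^+ q) Nu; rewrite !exprMn expr1n => ->.
  by rewrite -Nu; ring.
have : root (map_poly iota ('X^#|F| - 'X)) u.
  rewrite rmorphB /= map_polyXn map_polyX /root hornerD hornerN hornerXn hornerX cardF.
  by rewrite !expnS muln1 !exprM uq3 subrr.
rewrite finField_genPoly rmorph_prod /= /root horner_prod => /prodf_eq0[x _].
rewrite rmorphB /= map_polyX map_polyC /= hornerXsubC subr_eq0 => /eqP ->.
by exists x.
Qed.

(** The norm is the power of exponent 1 + q + q^2, and the multiplicative group
    is cyclic of order (q - 1) (1 + q + q^2). *)
Lemma hilbert90 (u : F) : u * u ^+ q * u ^+ q ^+ q = 1 ->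
  exists2 c : F, c != 0 & u = c ^+ q.-1.
Proof.
move=> Nu.
have q_gt1 : (1 < q)%N by rewrite -(exp1n k) ltn_exp2r // prime_gt1.
have cardF' : #|F|.-1 = (q.-1 * (1 + q + q ^ 2))%N.
  rewrite cardF; move: q_gt1; case: (q) => // n _ /=; nia.
have [w prim_w] : exists w : F, (#|F|.-1).-primitive_root w.
  have : has (#|F|.-1).-primitive_root (enum (predC1 (0 : F))).
    apply: has_prim_root; rewrite ?enum_uniq // -?cardE ?cardC1 //.
      by rewrite -subn1 subn_gt0 finNzRing_gt1.
    apply/allP => x; rewrite mem_enum unity_rootE => x_neq0.
    rewrite -(inj_eq (mulfI x_neq0)) -exprS prednK ?expf_card ?mulr1 //.
    by rewrite ltnW // finNzRing_gt1.
  by case/hasP => w _; exists w.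
have u1 : u ^+ (1 + q + q ^ 2) = 1 by rewrite !exprD expr1 -Nu -exprM.
have [|[i _] /= eu] := prim_rootP prim_w (_ : u ^+ #|F|.-1 = 1).
  by rewrite cardF' mulnC exprM u1 expr1n.
move/eqP: u1; rewrite eu -exprM -(prim_order_dvd prim_w) cardF' dvdn_pmul2r //.
case/dvdnP => j ->; exists (w ^+ j); last by rewrite exprM.
apply/expf_neq0; apply: contra_eq_neq (prim_expr_order prim_w) => ->.
by rewrite expr0n eqn0Ngt (prim_order_gt0 prim_w) eq_sym oner_neq0.
Qed.

Lemma no_norm1_zero_reducible (a b g : F) : g ^+ q = g -> b != 0 ->
  let a1 := a ^+ q in let a2 := a1 ^+ q in let b1 := b ^+ q in let b2 := b1 ^+ q in
  (forall u, let v := u ^+ q in let t := v ^+ q in u * v * t = 1 ->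
     trace_form a a1 a2 b b1 b2 g u v t != 0) ->
  a * b = b2 * a2 /\ b1 * b ^+ 2 - g * a2 * b + a1 * a2 ^+ 2 = 0.
Proof.
move=> gq b_neq0 a1 a2 b1 b2 no_root.
have [K [iota _]] := countable_algebraic_closure F.
have pcharK : p \in [pchar K] by rewrite (rmorph_pchar iota).
have [] := @no_norm1_zero_reducible_closed K p k pcharK k_gt0
  (iota a) (iota a1) (iota a2) (iota b) (iota b1) (iota b2) (iota g).
all: rewrite -/q -?rmorphXn /= ?frob3 ?gq ?fmorph_eq0 //.
- move=> u uvt; have [x ux] := norm1_in_subfield iota uvt; move: uvt.
  rewrite /trace_form ux -!rmorphXn -!rmorphM -!rmorphD -(rmorph1 iota) /= fmorph_eq0.
  by move/fmorph_inj; apply: no_root.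
- rewrite -!rmorphM => /fmorph_inj eab.
  by rewrite -rmorphB -rmorphD -(rmorph0 iota) => /fmorph_inj.
Qed.

(** * Planarity in terms of elements of norm 1 *)

Lemma cubic_normE (z : F) : cubic_norm q z = z * z ^+ q * z ^+ q ^+ q.
Proof. by rewrite /cubic_norm !exprD expr1 -exprM. Qed.

Lemma cubic_normM (x y : F) : cubic_norm q (x * y) = cubic_norm q x * cubic_norm q y.
Proof. exact: exprMn. Qed.

Lemma cubic_normN (x : F) : cubic_norm q (- x) = - cubic_norm q x.
Proof. by rewrite !cubic_normE !(frobN k pcharF) mulrNN mulrN. Qed.

(** The difference f (x + c) - f x is f c plus a form that is additive in x,
    so it is injective exactly when this form has trivial kernel. *)
Lemma planar_bilinear (a b : F) :
  planar (fun x : F => x ^+ (q + 1) + a * x ^+ (2 * q) + b * x ^+ 2) <->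
  forall x c, x != 0 -> c != 0 ->
    x ^+ q * c + x * c ^+ q + 2%:R * a * x ^+ q * c ^+ q + 2%:R * b * x * c != 0.
Proof.
set f := fun x : F => _.
pose L c x := x ^+ q * c + x * c ^+ q + 2%:R * a * x ^+ q * c ^+ q + 2%:R * b * x * c.
have fE c x : f (x + c) - f x = L c x + f c.
  have fE y : f y = y ^+ q * y + a * (y ^+ q * y ^+ q) + b * y ^+ 2.
    by rewrite /f !exprD expr0 mulr1.
  by rewrite !fE /L frobD; ring.
have LB c x y : L c (x - y) = L c x - L c y.
  by rewrite /L frobD (frobN k pcharF); ring.
split=> [pf x c x_neq0 c_neq0 | nz c c_neq0].
  apply: contra_neq x_neq0 => Lx0.
  have L0 : L c 0 = 0 by have := LB c 0 0; rewrite !subrr.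
  by apply: (bij_inj (pf c c_neq0)); rewrite !fE L0 [L c x]Lx0.
apply: injF_bij => x y; rewrite !fE => /addIr Lxy.
apply/eqP; rewrite -subr_eq0; apply: contraT => xy_neq0.
by have := nz _ _ xy_neq0 c_neq0; rewrite -[X in X != 0]/(L c (x - y)) LB Lxy subrr eqxx.
Qed.

(** Dividing the bilinear form by x * c leaves a function of x ^+ (q - 1) and
    c ^+ (q - 1), which range over the elements of norm 1. *)
Lemma planar_norm1 (a b : F) :
  planar (fun x : F => x ^+ (q + 1) + a * x ^+ (2 * q) + b * x ^+ 2) <->
  forall u v, cubic_norm q u = 1 -> cubic_norm q v = 1 ->
    u + v + 2%:R * a * u * v + 2%:R * b != 0.
Proof.
have q_gt0 : (0 < q)%N by rewrite expn_gt0 prime_gt0.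
have norm_c (c : F) : c != 0 -> cubic_norm q (c ^+ q.-1) = 1.
  move=> c_neq0; suff e : cubic_norm q (c ^+ q.-1) * c = 1 * c by apply: mulIf e.
  rewrite cubic_normE mul1r.
  have ec : c ^+ q = c * c ^+ q.-1 by rewrite -exprS prednK.
  rewrite -[RHS](frob3 c) ec !exprMn ec !exprMn ec; ring.
have factor (x c : F) :
    x ^+ q * c + x * c ^+ q + 2%:R * a * x ^+ q * c ^+ q + 2%:R * b * x * c =
    x * c * (x ^+ q.-1 + c ^+ q.-1 + 2%:R * a * x ^+ q.-1 * c ^+ q.-1 + 2%:R * b).
  by rewrite -{1 3}(prednK q_gt0) -[in c ^+ q](prednK q_gt0) !exprS; ring.
split=> [/planar_bilinear nz u v | nz].
  rewrite !cubic_normE => /hilbert90[x x_neq0 ->] /hilbert90[c c_neq0 ->].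
  by apply: contraNneq (nz x c x_neq0 c_neq0) => e; rewrite factor e mulr0.
apply/planar_bilinear => x c x_neq0 c_neq0.
by rewrite factor !mulf_neq0 // nz ?norm_c.
Qed.

(** The equation is v (1 + A u) = - (u + B), and -1 has norm -1: taking norms
    eliminates v, and conversely v = - (u + B) / (1 + A u) has norm 1.  When
    1 + A u = 0 the sum of norms forces u + B = 0, and every v is a
    solution. *)
Lemma norm1_pair_norm_sum (A B : F) :
  (forall u v, cubic_norm q u = 1 -> cubic_norm q v = 1 -> u + v + A * u * v + B != 0) <->
  (forall u, cubic_norm q u = 1 -> cubic_norm q (1 + A * u) + cubic_norm q (u + B) != 0).
Proof.
split=> nz u => [Nu | v Nu Nv].
  apply/eqP => e; have [Au0|Au_neq0] := eqVneq (1 + A * u) 0.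
    have uB0 : u + B = 0.
      move/eqP: e; rewrite Au0 /cubic_norm expr0n /= add0r expf_eq0 => /andP[_ /eqP //].
    have := nz u 1 Nu (expr1n _ _).
    rewrite [X in X != 0](_ : _ = (1 + A * u) + (u + B)); last by ring.
    by rewrite Au0 uB0 addr0 eqxx.
  have NAu_neq0 : cubic_norm q (1 + A * u) != 0 by rewrite expf_neq0.
  have Nv : cubic_norm q (- (u + B) / (1 + A * u)) = 1.
    apply: (mulIf NAu_neq0); rewrite -cubic_normM divfK // cubic_normN mul1r.
    by apply/eqP; rewrite eq_sym -addr_eq0 e.
  have := nz u _ Nu Nv; rewrite [X in X != 0](_ : _ = 0) ?eqxx //; field.
  exact: Au_neq0.
apply: contraNneq (nz u Nu) => uv0.
have e : v * (1 + A * u) = - (u + B) by rewrite -[RHS]addr0 -uv0; ring.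
have := cubic_normM v (1 + A * u); rewrite e cubic_normN Nv mul1r => <-.
by rewrite addNr.
Qed.

(** * From the trace form to the relation between a and b *)

Lemma norm_sum_trace_form (A B u : F) :
  let A1 := A ^+ q in let A2 := A1 ^+ q in let B1 := B ^+ q in let B2 := B1 ^+ q in
  cubic_norm q u = 1 ->
  cubic_norm q (1 + A * u) + cubic_norm q (u + B) =
  trace_form (A + B1 * B2) (A1 + B2 * B) (A2 + B * B1)
    (B + A1 * A2) (B1 + A2 * A) (B2 + A * A1)
    (2%:R + cubic_norm q A + cubic_norm q B) u (u ^+ q) (u ^+ q ^+ q).
Proof.
move=> A1 A2 B1 B2; rewrite !cubic_normE !(frobD, exprMn, expr1n) -/A1 -/A2 -/B1 -/B2.
set v := u ^+ q; set t := v ^+ q => Nu; rewrite /trace_form.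
rewrite [LHS](_ : _ = (A + B1 * B2) * u + (A1 + B2 * B) * v + (A2 + B * B1) * t
  + (B + A1 * A2) * (v * t) + (B1 + A2 * A) * (t * u) + (B2 + A * A1) * (u * v)
  + (1 + A * A1 * A2) * (u * v * t) + 1 + B * B1 * B2); last by ring.
by rewrite Nu; ring.
Qed.

(** With t = AB, n = N A and m = N B, the first relation of
    [no_norm1_zero_reducible] becomes (t - t'') (1 - t') = 0.  If t <> 1, then t
    is fixed by the q-power map, so B = t / A and its conjugates can be
    eliminated from the second relation, which becomes
    (1 - t)^2 (n + m + 2t) = 0 up to a unit. *)
Lemma no_norm1_zero_relation (A B : F) : A != 0 -> B != 0 ->
  (forall u, cubic_norm q u = 1 -> cubic_norm q (1 + A * u) + cubic_norm q (u + B) != 0) ->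
  A * B = 1 \/ cubic_norm q A + cubic_norm q B + 2%:R * (A * B) = 0.
Proof.
move=> A_neq0 B_neq0 nz.
pose A1 := A ^+ q; pose A2 := A1 ^+ q; pose B1 := B ^+ q; pose B2 := B1 ^+ q.
have A1_neq0 : A1 != 0 by rewrite expf_neq0.
have A2_neq0 : A2 != 0 by rewrite expf_neq0.
have A3 : A2 ^+ q = A by apply: frob3.
have B3 : B2 ^+ q = B by apply: frob3.
pose n := cubic_norm q A; pose m := cubic_norm q B.
have nE : n = A * A1 * A2 by rewrite /n cubic_normE.
have mE : m = B * B1 * B2 by rewrite /m cubic_normE.
pose a := A + B1 * B2; pose b := B + A1 * A2; pose g := 2%:R + n + m.
have a1E : a ^+ q = A1 + B2 * B by rewrite /a frobD exprMn B3.
have a2E : a ^+ q ^+ q = A2 + B * B1 by rewrite a1E frobD exprMn B3.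
have b1E : b ^+ q = B1 + A2 * A by rewrite /b frobD exprMn A3.
have b2E : b ^+ q ^+ q = B2 + A * A1 by rewrite b1E frobD exprMn A3.
have gq : g ^+ q = g.
  by rewrite /g !frobD expr1n /n /m !cubic_norm_subfield.
have nz' u : let v := u ^+ q in let t := v ^+ q in u * v * t = 1 ->
    trace_form a (a ^+ q) (a ^+ q ^+ q) b (b ^+ q) (b ^+ q ^+ q) g u v t != 0.
  move=> v t Nu; rewrite -cubic_normE in Nu.
  by have := nz u Nu; rewrite norm_sum_trace_form // a2E a1E b2E b1E.
(* Replacing u by 1 / u exchanges the roles of a and b, so b = 0 forces a = 0:
   otherwise the second relation with a and b exchanged would read
   a ^+ q * a ^+ 2 = 0. *)
have [b0|b_neq0] := eqVneq b 0.
  have q_neq0 : (q == 0)%N = false by rewrite eqn0Ngt expn_gt0 prime_gt0.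
  have a0 : a = 0.
    have [//|a_neq0] := eqVneq a 0.
    have [u v t Nu|_] := @no_norm1_zero_reducible b a g gq a_neq0.
      have v_q : v ^+ q = t by [].
      have t_q : t ^+ q = u by exact: frob3.
      have := nz' (v * t); rewrite /= !exprMn v_q t_q -/v.
      rewrite [v * t * _ * _](_ : _ = (u * v * t) ^+ 2); last by ring.
      rewrite Nu expr1n => /(_ erefl).
      rewrite [X in X != 0](_ : _ =
        trace_form b (b ^+ q) (b ^+ q ^+ q) a (a ^+ q) (a ^+ q ^+ q) g u v t +
        (u * v * t - 1) * (b * u + b ^+ q * v + b ^+ q ^+ q * t)); last first.
        by rewrite /trace_form; ring.
      by rewrite Nu subrr mul0r addr0.
    rewrite b0 !(expr0n, q_neq0) mulr0 !mul0r subr0 addr0 => /eqP.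
    by rewrite mulf_eq0 !expf_eq0 (negPf a_neq0) andbF.
  right; rewrite -/n -/m.
  have eA : A = - (B1 * B2) by apply/eqP; rewrite -addr_eq0 -/a a0.
  have eB : B = - (A1 * A2) by apply/eqP; rewrite -addr_eq0 -/b b0.
  have -> : n = - (A * B) by rewrite nE eB; ring.
  have -> : m = - (A * B) by rewrite mE eA; ring.
  ring.
have [] := no_norm1_zero_reducible gq b_neq0 nz'.
rewrite a2E a1E b2E b1E /a /b => rel1 rel2.
have [AB1|AB_neq1] := eqVneq (A * B) 1; first by left.
have A1B1 : (A * B) ^+ q = A1 * B1 by rewrite exprMn.
have A2B2 : (A1 * B1) ^+ q = A2 * B2 by rewrite exprMn.
have A3B3 : (A2 * B2) ^+ q = A * B by rewrite exprMn A3 B3.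
have A1B1_neq1 : A1 * B1 != 1.
  by apply: contra_neq AB_neq1 => e; rewrite -A3B3 -A2B2 e !expr1n.
have eAB2 : A * B = A2 * B2.
  apply/eqP; rewrite -subr_eq0; rewrite -subr_eq0 in A1B1_neq1.
  rewrite -(mulrI_eq0 _ (mulfI A1B1_neq1)) -oppr_eq0; apply/eqP.
  by rewrite -[RHS](subrr ((A + B1 * B2) * (B + A1 * A2))) {2}rel1; ring.
have eAB1 : A * B = A1 * B1 by rewrite -A1B1 {2}eAB2 A3B3.
pose t := A * B.
have Bt : B = t / A by rewrite /t mulrC mulKf.
have B1t : B1 = t / A1 by rewrite /t eAB1 mulrC mulKf.
have B2t : B2 = t / A2 by rewrite /t eAB2 mulrC mulKf.
right; rewrite -/n -/m -/t.
have : - (1 - t) ^+ 2 * A2 / A * (n + m + 2%:R * t) = 0.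
  by rewrite -[RHS]rel2 /g nE mE Bt B1t B2t; field; rewrite A_neq0 A1_neq0 A2_neq0.
move/eqP; rewrite !mulf_eq0 oppr_eq0 expf_eq0 invr_eq0 (negPf A_neq0) (negPf A2_neq0) !orbF /=.
by rewrite subr_eq0 eq_sym (negPf AB_neq1) => /eqP.
Qed.

(** With t = AB, n = N A and m = N B, the hypothesis makes t fixed by the
    q-power map, so m = t^3 / n and n^2 + 2 t n + t^3 = 0.  Modulo the latter,
    the sum of norms is (t + n) n / t^2 times N (1 - (t / n) A u).  The norm of
    (t / n) A u is t^3 / n^2, which is 1 only if t + n = 0, and then t = 1. *)
Lemma relation_no_norm1_zero (A B : F) : 2%:R != 0 :> F -> A != 0 -> B != 0 -> A * B != 1 ->
  cubic_norm q A + cubic_norm q B + 2%:R * (A * B) = 0 ->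
  forall u, cubic_norm q u = 1 -> cubic_norm q (1 + A * u) + cubic_norm q (u + B) != 0.
Proof.
move=> two_neq0 A_neq0 B_neq0 AB_neq1 rel u Nu.
pose A1 := A ^+ q; pose A2 := A1 ^+ q; pose B1 := B ^+ q; pose B2 := B1 ^+ q.
have A1_neq0 : A1 != 0 by rewrite expf_neq0.
have A2_neq0 : A2 != 0 by rewrite expf_neq0.
pose n := cubic_norm q A; pose m := cubic_norm q B; pose t := A * B.
have nE : n = A * A1 * A2 by rewrite /n cubic_normE.
have n_neq0 : n != 0 by rewrite expf_neq0.
have t_neq0 : t != 0 by rewrite mulf_neq0.
have two_q : 2%:R ^+ q = 2%:R :> F by rewrite frobD expr1n.
have nq : n ^+ q = n by rewrite cubic_norm_subfield.
have tq : t ^+ q = t.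
  have e2t : 2%:R * t = - (n + m) by apply/eqP; rewrite -addr_eq0 addrC rel.
  apply: (mulfI two_neq0); rewrite -{1}two_q -exprMn e2t (frobN k pcharF) frobD.
  by rewrite /n /m !cubic_norm_subfield.
have Bt : B = t / A by rewrite /t mulrC mulKf.
have B1t : B1 = t / A1 by rewrite /B1 Bt exprMn exprVn tq.
have B2t : B2 = t / A2 by rewrite /B2 B1t exprMn exprVn tq.
have mt : m = t ^+ 3 / n.
  by rewrite /m cubic_normE -/B1 -/B2 {1}Bt B1t B2t nE; field; rewrite A_neq0 A1_neq0 A2_neq0.
have R0 : n ^+ 2 + 2%:R * t * n + t ^+ 3 = 0.
  have -> : n ^+ 2 + 2%:R * t * n + t ^+ 3 = n * (n + t ^+ 3 / n + 2%:R * t) by field.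
  by rewrite -mt rel mulr0.
have tn_neq0 : t + n != 0.
  apply: contra_neq AB_neq1 => tn0.
  have nt : n = - t by apply/eqP; rewrite -addr_eq0 addrC tn0.
  apply: (mulfI (expf_neq0 2 t_neq0)); apply/eqP.
  by rewrite -/t mulr1 -subr_eq0 -R0 nt; apply/eqP; ring.
pose w := t / n * A * u.
have wE : cubic_norm q (1 - w) != 0.
  rewrite expf_neq0 // subr_eq0; apply: contra_neq tn_neq0 => w1.
  have : cubic_norm q w = 1 by rewrite -w1 /cubic_norm expr1n.
  rewrite /w (cubic_normM _ u) (cubic_normM _ A) (cubic_normM t) Nu mulr1 -/n.
  rewrite !cubic_normE !exprVn !tq !nq => e.
  have et : t ^+ 3 = n ^+ 2.
    by rewrite -[RHS]mulr1 -e; field.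
  apply: (mulfI (mulf_neq0 two_neq0 n_neq0)); rewrite mulr0 -R0 et; ring.
suff -> : cubic_norm q (1 + A * u) + cubic_norm q (u + B) =
    (t + n) * n / t ^+ 2 * cubic_norm q (1 - w).
  by rewrite !mulf_neq0 // invr_neq0 // expf_neq0.
rewrite norm_sum_trace_form // -/A1 -/B1 -/A2 -/B2 -/n -/m.
have w_q x y : (t / n * x * y) ^+ q = t / n * x ^+ q * y ^+ q.
  by rewrite [(_ * y) ^+ q]exprMn [(_ * x) ^+ q]exprMn [(t / n) ^+ q]exprMn exprVn tq nq.
rewrite cubic_normE !(frobD, frobN k pcharF, expr1n) /w !w_q -/A1 -/A2.
move: Nu; rewrite cubic_normE; set v := u ^+ q; set x := v ^+ q => Nu.
have uv_neq0 : u * v != 0.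
  by apply: contra_eq_neq Nu => ->; rewrite mul0r eq_sym oner_neq0.
have xE : x = (u * v)^-1 by apply: (mulfI uv_neq0); rewrite Nu mulfV.
move: uv_neq0; rewrite mulf_eq0 negb_or => /andP[u_neq0 v_neq0].
rewrite /trace_form mt Bt B1t B2t xE.
(* The difference of the two sides is a multiple of n ^+ 2 + 2 t n + t ^+ 3. *)
rewrite -[RHS]addr0 -[X in _ = _ + X](mul0r ((A * u + A1 * v + A2 / (u * v)) / (t * n)
  + (t + t ^+ 2 - n) / (t ^+ 2 * n))) -R0 nE.
by field; rewrite A_neq0 A1_neq0 A2_neq0 t_neq0 u_neq0 v_neq0.
Qed.
End CubicExtension.

Theorem theorem5 (p k q : nat) (p_prime : prime p) (p_odd : odd p)
    (k_gt0 : (0 < k)%N) (q_def : q = (p ^ k)%N)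
    (F : finFieldType) (cardF : #|F| = (q ^ 3)%N)
    (a b : F) (a_neq0 : a != 0) (b_neq0 : b != 0) :
  planar (fun x : F => x ^+ (q + 1) + a * x ^+ (2 * q) + b * x ^+ 2) <->
  (4%:R * a * b = 1 /\ cubic_norm q (2%:R * a) <> -1) \/
  (4%:R * a * b <> 1 /\ cubic_norm q a + cubic_norm q b + a * b = 0).
Proof.
subst q; set q := (p ^ k)%N in cardF *.
have pcharF : p \in [pchar F].
  by apply: (@card_finPcharP F p (k * 3)) => //; rewrite cardF -expnM.
have two_neq0 : 2%:R != 0 :> F.
  rewrite -(dvdn_pcharf pcharF); apply/negP => /dvdn_leq => /(_ isT).
  by case: (p) p_prime p_odd => [|[|[|]]].
have A_neq0 : 2%:R * a != 0 by rewrite mulf_neq0.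
have B_neq0 : 2%:R * b != 0 by rewrite mulf_neq0.
have ABE : (2%:R * a) * (2%:R * b) = 4%:R * a * b by ring.
have norm2 (x : F) : cubic_norm q (2%:R * x) = 8%:R * cubic_norm q x.
  rewrite cubic_normM cubic_normE; congr (_ * _).
  have two_q : 2%:R ^+ q = 2%:R :> F by rewrite (frobD k pcharF) expr1n.
  by rewrite !two_q; ring.
have relE : cubic_norm q (2%:R * a) + cubic_norm q (2%:R * b) + 2%:R * (4%:R * a * b) =
    8%:R * (cubic_norm q a + cubic_norm q b + a * b) by rewrite !norm2; ring.
have eight_neq0 : 8%:R != 0 :> F.
  by rewrite (_ : 8%:R = 2%:R ^+ 3) ?expf_neq0 //; ring.
have normN1 : cubic_norm q (-1 : F) = -1.
  by rewrite (cubic_normN p_prime cardF) /cubic_norm expr1n.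
have planarE := planar_norm1 p_prime k_gt0 cardF a b.
have pairE := norm1_pair_norm_sum p_prime cardF (2%:R * a) (2%:R * b).
have splitE : 4%:R * a * b = 1 -> forall u v, u + v + 2%:R * a * u * v + 2%:R * b =
    (1 + 2%:R * a * u) * (v + 2%:R * b).
  move=> AB1 u v; rewrite [RHS](_ : _ = u * (4%:R * a * b) + v + 2%:R * a * u * v + 2%:R * b).
    by rewrite AB1 mulr1.
  by ring.
split=> [/planarE nz | [[AB1 NA] | [AB_neq1 rel]]].
- have NA : 4%:R * a * b = 1 -> cubic_norm q (2%:R * a) <> -1.
    move=> AB1 NA1; have Nu : cubic_norm q (- (2%:R * a)^-1) = 1.
      rewrite (cubic_normN p_prime cardF) {1}/cubic_norm exprVn -/(cubic_norm q (2%:R * a)).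
      by rewrite NA1 invrN invr1 opprK.
    have /negP[] := nz _ 1 Nu (expr1n _ _).
    by rewrite (splitE AB1) mulrN divff // subrr mul0r.
  have [|] := no_norm1_zero_relation p_prime k_gt0 cardF A_neq0 B_neq0 (pairE.1 nz).
    by rewrite ABE => AB1; left; split; last exact: NA.
  rewrite ABE => rel; have [AB1|/eqP AB_neq1] := eqVneq (4%:R * a * b) 1.
    by left; split; last exact: NA.
  right; split=> //; apply: (mulfI eight_neq0).
  by rewrite -relE rel mulr0.
- apply/planarE => u v Nu Nv.
  have N_neq1 x : cubic_norm q x = 1 -> 2%:R * a * x != -1.
    by move=> Nx; apply/eqP => ax; apply: NA; rewrite -normN1 -ax [RHS]cubic_normM Nx mulr1.
  rewrite (splitE AB1) mulf_neq0 //; first by rewrite addrC addr_eq0 N_neq1.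
  rewrite addr_eq0; apply: contra_neq (N_neq1 v Nv) => ->.
  by rewrite mulrN ABE AB1.
- apply/planarE/pairE; apply: (relation_no_norm1_zero p_prime cardF) => //.
    by rewrite ABE; apply/eqP.
  by rewrite ABE relE rel mulr0.
Qed.
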